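(* Let $\mathcal{C}$ be the Calderón commutator associated with $A(x)=|x|$ on $\mathbb{R}$, i.e. the operator with kernel $\frac{|x|-|y|}{(x-y)^2}$. Then $\mathcal{C}$ is unbounded on $\mathrm{BMO}(\mathbb{R})$; that is, there is no constant $C$ such that $\|\mathcal{C}f\|_{\mathrm{BMO}}\le C\|f\|^*_{\mathrm{BMO}}$ for all $f\in\mathrm{BMO}(\mathbb{R})$.
   Context: Functions are real-valued. $\mathcal{C}$ is taken in the principal value sense: $\mathcal{C}f(x)=\mathrm{p.v.}\int_{\mathbb{R}}\frac{|x|-|y|}{(x-y)^2}f(y)\,dy$; it is bounded on $L^2(\mathbb{R})$ (classical). Cubes in $\mathbb{R}$ are bounded intervals $Q$ with centre $c$ and length $|Q|$; $2Q$ is the interval with the same centre and length $2|Q|$; $f_Q=\frac1{|Q|}\int_Q f\,dx$; $Q_0$ is the interval of centre $0$ and length $1$. Oscillation: $\|f\|_Q=\inf_{b\in\mathbb{R}}\frac1{|Q|}\int_Q|f-b|\,dx$. $\mathrm{BMO}(\mathbb{R})$ is the set of $f\in L^1_{loc}(\mathbb{R})$ with finite seminorm $\|f\|_{\mathrm{BMO}}=\sup_Q\|f\|_Q$; its norm is $\|f\|^*_{\mathrm{BMO}}=\|f\|_{\mathrm{BMO}}+|f_{Q_0}|$. Action on BMO: for an $L^2$-bounded operator $T$ with kernel $K$, an interval $Q$ with centre $c$, and $f\in\mathrm{BMO}(\mathbb{R})$, put for $x\in Q$ $$T_Qf(x)=T(\chi_{2Q}f)(x)+\int_{\mathbb{R}\setminus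 2Q}(K(x,y)-K(c,y))f(y)\,dy$$ (understood via $T_Qf=f_{2Q}T_Q1+T_Q(f-f_{2Q})$), and define $\|Tf\|_{\mathrm{BMO}}=\sup_Q\|T_Qf\|_Q\in[0,\infty]$. This is applied with $T=\mathcal{C}$. *)

(* Defs.v *)
From HB Require Import structures.
From mathcomp Require Import all_boot all_order all_algebra.
From mathcomp Require Import all_classical all_reals all_analysis.

Set Implicit Arguments.
Unset Strict Implicit.
Unset Printing Implicit Defensive.

Import Order.TTheory GRing.Theory Num.Theory.
Import numFieldNormedType.Exports.

Local Open Scope classical_set_scope.
Local Open Scope ring_scope.

Section BMO.
Context {R : realType}.
Implicit Types (f : R -> R) (c l : R).
Local Notation mu := (@lebesgue_measure R).

(* The cube of centre [c] and length [l], always used with [0 < l]. It is taken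
   closed: endpoints do not affect any of the integrals below. *)
Definition cube c l : set R := `[c - l / 2, c + l / 2].

(* [f_Q], for [Q = cube c l] *)
Definition mean f c l : R := l^-1 * \int[mu]_(x in cube c l) f x.

(* [||f||_Q], for [Q = cube c l]; [iavg g Q] is the average of [|g|] over [Q]. *)
Definition oscillation f c l : \bar R :=
  ereal_inf (range (fun b : R => iavg (fun x => f x - b) (cube c l))).

Definition BMO_seminorm f : \bar R :=
  ereal_sup [set oscillation f q.1 q.2 | q in [set q : R * R | 0 < q.2]].

Definition BMO : set (R -> R) :=
  [set f | locally_integrable setT f /\ (BMO_seminorm f < +oo)%E].

(* [||f||^*_BMO], with [Q_0 = cube 0 1] *)
Definition BMO_norm f : \bar R := (BMO_seminorm f + `|mean f 0 1|%:E)%E.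

End BMO.

Section SingularIntegral.
Context {R : realType}.
Implicit Types (K : R -> R -> R) (T : (R -> R) -> R -> R).
Implicit Types (f : R -> R) (c l x : R).
Local Notation mu := (@lebesgue_measure R).

(* Principal value operator with kernel [K]. Where the limit does not exist,
   [lim] returns a default value; for the kernel below and square-integrable
   [f] this only happens on a null set. *)
Definition pv_operator K f x : R :=
  lim ((\int[mu]_(y in [set y | e < `|x - y|]) (K x y * f y)) @[e --> 0^'+]).

(* T(chi_{2Q} f)(x) + \int_{R \ 2Q} (K(x,y) - K(c,y)) f(y) dy,
   for [Q = cube c l]. *)
Definition local_action0 T K c l f x : R :=
  T (fun y => \1_(cube c (2 * l)) y * f y) x
  + \int[mu]_(y in ~` cube c (2 * l)) ((K x y - K c y) * f y).

(* T_Q f = f_{2Q} T_Q 1 + T_Q (f - f_{2Q}), for [Q = cube c l]; only the values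
   at [x] in [Q] are meaningful. *)
Definition local_action T K c l f x : R :=
  let m := mean f c (2 * l) in
  m * local_action0 T K c l (fun=> 1) x
  + local_action0 T K c l (fun y => f y - m) x.

(* [||T f||_BMO] = sup over Q of [||T_Q f||_Q] *)
Definition BMO_action_seminorm T K f : \bar R :=
  ereal_sup [set oscillation (local_action T K q.1 q.2 f) q.1 q.2
            | q in [set q : R * R | 0 < q.2]].

(* At [x = y] division by zero gives the value 0; the diagonal plays no role. *)
Definition calderon_kernel (x y : R) : R := (`|x| - `|y|) / (x - y) ^+ 2.

Definition calderon_commutator : (R -> R) -> R -> R :=
  pv_operator calderon_kernel.

End SingularIntegral.

(* Main.v *)
Require Import Defs.
From HB Require Import structures.
From mathcomp Require Import all_boot all_order all_algebra.
From mathcomp Require Import all_classical all_reals all_analysis.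
From mathcomp Require Import measurable_realfun ring lra.

Set Implicit Arguments.
Unset Strict Implicit.
Unset Printing Implicit Defensive.

Import Order.TTheory GRing.Theory Num.Theory.
Import numFieldNormedType.Exports.

Local Open Scope classical_set_scope.
Local Open Scope ring_scope.

(** The kernel of [C] is homogeneous of degree -1, so the oscillation of
    [T_Q 1] does not change when [Q] is dilated, and for cubes away from the
    origin it is not zero: if [Q] has centre [c] and [2Q = [a, b]] lies in
    the positive half-line, then
      T_Q 1 (x) = 2 (ln x - ln c) + constant       (x in Q).
    Since T_Q f = f_{2Q} T_Q 1 + T_Q (f - f_{2Q}), a function of bounded BMO
    norm whose mean over [2Q] is large makes [T_Q f] oscillate as much as that
    mean, provided that the second term stays bounded.

    The function used is f_N (y) = ln (1 + min (|y|, N)). Its BMO norm is at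
    most 4 whatever [N] is ([BMO_norm_truncated_log]), because the logarithm
    differs on an interval from its largest value there by a bounded amount in
    the mean ([log_defect]). For [Q = [3N, 5N]] the function f_N is equal to
    [ln (1 + N)] on [2Q = [2N, 6N]], so f_N - f_{2Q} vanishes on [2Q] and
    T_Q (f_N - f_{2Q}) has no singular part: it is the integral of
    K(x,y) - K(c,y) = O(1/N) against f_N - ln (1 + N) over [-N, N], which is
    at most 2 by the same mean estimate ([norm_far_field_le]). Hence on the left
    half of [Q] the function T_Q f_N is within 2 of
    2 ln (1 + N) (ln x - ln c) ([local_action_truncated_log]), its oscillation
    over [Q] is of order [ln (1 + N)] ([BMO_action_truncated_log]), and [N] can
    be taken arbitrarily large.

    The formula for T_Q 1 comes from explicit primitives. For y > 0 the kernel
    is that of the Hilbert transform, 1 / (x - y), whose contributions to T_Q 1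
    inside and outside [2Q] leave [ln x - ln c] and constants; for y < 0 it is
    - 1 / (x - y) + 2 x / (x - y)^2, and contributes another [ln x - ln c]. *)

(** * Integrals with a known value *)

(** The real-valued integral of a function that is not integrable is still some
    number, so a value is recorded together with integrability; this is what
    makes values add up over sums and disjoint unions. *)
Definition has_integral {R : realType} (D : set R) (f : R -> R) (v : R) :=
  (@lebesgue_measure R).-integrable D (EFin \o f) /\
  \int[@lebesgue_measure R]_(x in D) f x = v.

Section HasIntegral.
Context {R : realType}.
Implicit Types (D : set R) (f g F : R -> R) (a b v w : R).
Local Notation mu := (@lebesgue_measure R).

Lemma has_integral_fine D f v : measurable D -> measurable_fun D f ->
  (forall x, D x -> 0 <= f x) ->
  (\int[mu]_(x in D) (f x)%:E = v%:E)%E -> has_integral D f v.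
Proof.
move=> mD mf f0 intf; split; last by rewrite /Rintegral intf.
apply/integrableP; split; first exact/measurable_EFinP.
rewrite (_ : integral _ _ _ = v%:E) ?ltry// -intf; apply: eq_integral => x.
by rewrite inE => /f0 fx0 /=; rewrite ger0_norm.
Qed.

Lemma eq_has_integral D f g v : measurable D -> (forall x, D x -> f x = g x) ->
  has_integral D f v -> has_integral D g v.
Proof.
move=> mD fg [intf <-]; split.
  have := @eq_integrable _ _ _ mu D mD (EFin \o f) (EFin \o g).
  apply => // x; rewrite inE => Dx /=.
  by rewrite fg.
by apply: eq_Rintegral => x; rewrite inE => Dx; rewrite fg.
Qed.

Lemma has_integralD D f g v w : measurable D ->
  has_integral D f v -> has_integral D g w ->
  has_integral D (fun x => f x + g x) (v + w).
Proof.
move=> mD [intf <-] [intg <-]; split; last by rewrite RintegralD.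
have := @integrableD _ _ _ mu D mD (EFin \o f) (EFin \o g) intf intg.
by apply: (@eq_integrable _ _ _ mu D mD) => x _ /=; rewrite EFinD.
Qed.

Lemma has_integralZ D f v k : measurable D ->
  has_integral D f v -> has_integral D (fun x => k * f x) (k * v).
Proof.
move=> mD [intf <-]; split; last by rewrite RintegralZl.
have := @integrableZl _ _ _ mu D mD k (EFin \o f) intf.
by apply: (@eq_integrable _ _ _ mu D mD) => x _ /=; rewrite EFinM.
Qed.

Lemma has_integralN D f v : measurable D ->
  has_integral D f v -> has_integral D (fun x => - f x) (- v).
Proof.
move=> mD /(has_integralZ (-1) mD); rewrite mulN1r.
by apply: eq_has_integral => // x _; rewrite mulN1r.
Qed.

Lemma has_integralU D E f v w : measurable D -> measurable E ->
  [disjoint D & E] -> has_integral D f v -> has_integral E f w ->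
  has_integral (D `|` E) f (v + w).
Proof.
move=> mD mE DE [intfD vE] [intfE wE].
have intU : mu.-integrable (D `|` E) (EFin \o f).
  have /integrableP[mfD fDoo] := intfD; have /integrableP[mfE fEoo] := intfE.
  have mfU : measurable_fun (D `|` E) (EFin \o f) by exact/measurable_funU.
  apply/integrableP; split=> //.
  rewrite ge0_integral_setU//; last exact: measurableT_comp.
  exact: lte_add_pinfty.
by split; rewrite // Rintegral_setU// vE wE.
Qed.

Lemma integrable_itv_continuous a b f :
  (forall x, a <= x <= b -> {for x, continuous f}) ->
  mu.-integrable `[a, b] (EFin \o f).
Proof.
move=> cf; apply: continuous_compact_integrable; first exact: segment_compact.
by apply: continuous_in_subspaceT => x; rewrite inE/= in_itv/= => /cf.
Qed.

Lemma has_integral_FTC a b f F : a < b ->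
  (forall x, a <= x <= b -> is_derive x 1 F (f x)) ->
  (forall x, a <= x <= b -> {for x, continuous f}) ->
  has_integral `[a, b] f (F b - F a).
Proof.
move=> ab dF cf; split; first exact: integrable_itv_continuous.
have dF' x : a <= x <= b -> derivable F x 1 by case/dF.
have cF x : a <= x <= b -> {for x, continuous F}.
  by move=> /dF' /derivable1_diffP/differentiable_continuous.
rewrite /Rintegral (@continuous_FTC2 _ _ F)//.
- by apply: continuous_in_subspaceT => x; rewrite inE/= in_itv/= => /cf.
- split.
  + by move=> x; rewrite in_itv/= => /andP[/ltW ? /ltW ?]; apply: dF'; apply/andP.
  + by apply: cvg_at_right_filter; apply: cF; rewrite lexx ltW.
  + by apply: cvg_at_left_filter; apply: cF; rewrite lexx ltW.
- move=> x; rewrite in_itv/= => /andP[/ltW ax /ltW xb].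
  by rewrite derive1E; apply: (@derive_val _ _ _ _ _ _ _ (dF x _)); apply/andP.
Qed.

(** The sign condition gives integrability at infinity from the limit of the
    primitive. *)
Lemma has_integral_FTCy a f F v :
  (forall x, a <= x -> is_derive x 1 F (f x)) ->
  (forall x, a <= x -> {for x, continuous f}) ->
  (forall x, a <= x -> 0 <= f x) -> F x @[x --> +oo] --> v ->
  has_integral `[a, +oo[ f (v - F a).
Proof.
move=> dF cf f0 Fv.
have cf' : {within `[a, +oo[, continuous f}.
  by apply: continuous_in_subspaceT => x; rewrite inE/= in_itv/= andbT => /cf.
apply: has_integral_fine => //.
- by apply: subspace_continuous_measurable_fun.
- by move=> x /=; rewrite in_itv/= andbT; exact: f0.
- rewrite (@ge0_continuous_FTC2y _ _ F _ v)//.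
  + by move=> x /ltW/dF[].
  + apply: cvg_at_right_filter.
    have /derivable1_diffP/differentiable_continuous : derivable F a 1.
      by case: (dF a (lexx _)).
    exact.
  + move=> x; rewrite in_itv/= andbT => /ltW ax.
    by rewrite derive1E; apply: (@derive_val _ _ _ _ _ _ _ (dF x _)).
Qed.

Lemma has_integral_oppr a b f v : a <= b ->
  (forall x, a <= x <= b -> {for (- x), continuous f}) ->
  has_integral `[a, b] (fun x => f (- x)) v ->
  has_integral `[- b, - a] f v.
Proof.
move=> ab cf [_ <-].
have cf' x : - b <= x <= - a -> {for x, continuous f}.
  by rewrite -(opprK x) !lerN2 andbC; exact: cf.
split; first exact: integrable_itv_continuous.
congr fine; rewrite integration_by_substitution_oppr//.
by apply: continuous_in_subspaceT => x; rewrite inE/= in_itv/=; exact: cf'.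
Qed.

Lemma has_integral_oppry f v :
  (forall x, 0 <= x -> {for (- x), continuous f}) ->
  (forall x, 0 <= x -> 0 <= f (- x)) ->
  has_integral `[0, +oo[ (fun x => f (- x)) v ->
  has_integral `]-oo, 0] f v.
Proof.
move=> cf f0 [intf intv].
have cf' x : x <= 0 -> {for x, continuous f}.
  by rewrite -oppr_ge0 => /cf; rewrite opprK.
have cf'' : {within `]-oo, - 0], continuous f}.
  apply: continuous_in_subspaceT => x; rewrite inE/= in_itv/= oppr0.
  exact: cf'.
apply: has_integral_fine => //.
- by apply: subspace_continuous_measurable_fun => //; rewrite oppr0 in cf''.
- by move=> x /=; rewrite in_itv/= -oppr_ge0 => /f0; rewrite opprK.
- have := @ge0_integration_by_substitutionNy _ f 0 cf''.
  rewrite oppr0 => ->; last first.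
    move=> x /=; rewrite in_itv/= => /ltW.
    by rewrite -oppr_ge0 => /f0; rewrite opprK.
  rewrite -intv /Rintegral fineK//; exact: integrable_fin_num intf.
Qed.

Lemma has_integralD1 D r f v : measurable D -> has_integral D f v ->
  has_integral (D `\ r) f v.
Proof.
move=> mD [intf <-].
have mDr : measurable (D `\ r) by exact: measurableD.
have intfr : mu.-integrable (D `\ r) (EFin \o f).
  by apply: integrableS intf => //; exact: subDsetl.
split=> //; congr fine; apply: integral_setD1 => //.
exact: measurable_int intfr.
Qed.

End HasIntegral.

(** * The kernel and its elementary pieces *)

Section KernelIntegrals.
Context {R : realType}.
Implicit Types (a b c p q x y s : R).
Local Notation K := (@calderon_kernel R).

Lemma is_derive_shift s p : is_derive s 1 (fun t : R => t + p) 1.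
Proof. by rewrite -[X in is_derive _ _ _ X]addr0; exact: is_deriveD. Qed.

Lemma is_derive_lnD p s : 0 < s + p ->
  is_derive s 1 (fun t => ln (t + p)) (s + p)^-1.
Proof.
move=> sp; have := is_derive1_ln sp => dln.
have d1 := is_derive_shift s p.
have := @is_derive1_comp _ (@ln R) (fun t => t + p) s _ _ dln d1.
by rewrite mulr1.
Qed.

Lemma is_derive_lnB p s : s < p ->
  is_derive s 1 (fun t => ln (p - t)) (- (p - s)^-1).
Proof.
rewrite -subr_gt0 => sp; have := is_derive1_ln sp => dln.
have d1 : is_derive s 1 (fun t : R => p - t) (-1).
  by rewrite -[X in is_derive _ _ _ X]add0r; exact: is_deriveB.
have := @is_derive1_comp _ (@ln R) (fun t => p - t) s _ _ dln d1.
by rewrite mulrN1.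
Qed.

Lemma continuous_invD p s : s + p != 0 ->
  {for s, continuous (fun t => (t + p)^-1)}.
Proof.
by move=> sp; apply: cvgV => //; apply: cvgD; [exact: cvg_id|exact: cvg_cst].
Qed.

Lemma continuous_invB p s : p - s != 0 ->
  {for s, continuous (fun t => (p - t)^-1)}.
Proof.
by move=> sp; apply: cvgV => //; apply: cvgB; [exact: cvg_cst|exact: cvg_id].
Qed.

Lemma continuous_inv_sqrB p s : p - s != 0 ->
  {for s, continuous (fun t => (p - t) ^- 2)}.
Proof.
move=> ps; apply: cvgV; first by rewrite expf_neq0.
have c1 : p - t @[t --> s] --> p - s.
  by apply: cvgB; [exact: cvg_cst|exact: cvg_id].
exact: (cvgM c1 c1).
Qed.

Lemma continuous_kernel x y : x != y -> {for y, continuous (K x)}.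
Proof.
move=> xy; have xy0 : x - y != 0 by rewrite subr_eq0.
apply: cvgM; last exact: continuous_inv_sqrB.
apply: cvgB; first exact: cvg_cst.
by apply: cvg_norm; exact: cvg_id.
Qed.

Lemma cvg_invDy p : (s + p)^-1 @[s --> +oo] --> (0 : R).
Proof.
apply/(gtr0_cvgV0 (f := fun s => s + p)); last exact: cvg_addrr.
near=> s; rewrite -[ltLHS](addNr p) ltrD2r.
by near: s; exact: (nbhs_pinfty_gt (num_real _)).
Unshelve. all: by end_near. Qed.

(** Each of the two terms has an infinite integral; their primitives combine to
    [ln ((s + p) / (s + q))], which vanishes at infinity. *)
Lemma has_integral_log_tail a p q : p <= q -> 0 < a + p ->
  has_integral `[a, +oo[ (fun s => (s + p)^-1 - (s + q)^-1)
    (ln (a + q) - ln (a + p)).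
Proof.
move=> pq ap; pose F s := ln (s + p) - ln (s + q).
have sp s : a <= s -> 0 < s + p by lra.
have sq s : a <= s -> 0 < s + q by lra.
rewrite (_ : _ - _ = 0 - F a); last by rewrite /F; ring.
apply: has_integral_FTCy.
- by move=> s as_; apply: is_deriveB; apply: is_derive_lnD; [exact: sp|exact: sq].
- move=> s as_; apply: cvgB; apply: continuous_invD; rewrite gt_eqF//;
    [exact: sp|exact: sq].
- by move=> s as_; rewrite subr_ge0 lef_pV2 ?posrE ?sp ?sq// lerD2l.
- have h : 1 - (q - p) * (s + q)^-1 @[s --> +oo] --> (1 : R).
    rewrite [X in _ --> X](_ : _ = 1 - (q - p) * 0); last by ring.
    apply: cvgB; first exact: cvg_cst.
    by apply: cvgM; [exact: cvg_cst|exact: cvg_invDy].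
  have := continuous_cvg _ (@continuous_ln _ 1 ltr01) h.
  rewrite ln1 => lnh. apply: (cvg_trans _ (lnh _)); apply: near_eq_cvg; near=> s.
  have as_ : a <= s by near: s; exact: (nbhs_pinfty_ge (num_real _)).
  rewrite /F -ln_div ?posrE ?sp ?sq//; congr ln.
  by field; rewrite gt_eqF// sq.
Unshelve. all: by end_near. Qed.

Lemma has_integral_inv_sqr_tail p : 0 < p ->
  has_integral `[0, +oo[ (fun s => p / (s + p) ^+ 2) 1.
Proof.
move=> p0; pose F s := - p * (s + p)^-1.
have sp s : 0 <= s -> 0 < s + p by lra.
rewrite (_ : 1 = 0 - F 0); last by rewrite /F; field; rewrite gt_eqF.
apply: has_integral_FTCy.
- move=> s /sp s0.
  have d1 := is_derive_shift s p.
  have d2 := @is_deriveV _ (fun t : R => t + p) s 1 1 (lt0r_neq0 s0) d1.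
  have d3 := @is_deriveZ _ _ _ _ (- p) _ _ _ d2.
  apply: (is_derive_eq d3); rewrite -[_ *: _]/(- p * (- (s + p) ^- 2 * 1)).
  by rewrite mulr1 mulrNN.
- move=> s /sp /lt0r_neq0 s0.
  apply: cvgM; first exact: cvg_cst.
  apply: cvgV; first by rewrite expf_neq0.
  have c2 : (fun t => t + p) t @[t --> s] --> s + p.
    by apply: cvgD; [exact: cvg_id|exact: cvg_cst].
  exact: (cvgM c2 c2).
- by move=> s s0; rewrite divr_ge0 ?sqr_ge0 ?ltW.
- rewrite -[X in _ --> X](mulr0 (- p)).
  by apply: cvgM; [exact: cvg_cst|exact: cvg_invDy].
Qed.

End KernelIntegrals.

(** * The action of the commutator on constants *)

Section KernelTails.
Context {R : realType}.
Implicit Types (a b c p q x y s : R).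
Local Notation K := (@calderon_kernel R).

Lemma has_integral_log_left p q : 0 < p <= q ->
  has_integral `]-oo, 0] (fun y => (p - y)^-1 - (q - y)^-1) (ln q - ln p).
Proof.
move=> /andP[p0 pq]; apply: has_integral_oppry.
- move=> s s0; apply: cvgB; apply: continuous_invB; rewrite gt_eqF//; lra.
- by move=> s s0; rewrite subr_ge0 lef_pV2 ?posrE; lra.
- rewrite -[X in ln X - _]add0r -[X in _ - ln X]add0r.
  apply: (eq_has_integral _ _ (has_integral_log_tail pq _)) => //; last lra.
  by move=> s _; rewrite !opprK ![_ + s]addrC.
Qed.

Lemma has_integral_inv_sqr_left p : 0 < p ->
  has_integral `]-oo, 0] (fun y => p / (p - y) ^+ 2) 1.
Proof.
move=> p0; apply: has_integral_oppry.
- move=> s s0; have ps : p - - s != 0 by rewrite gt_eqF//; lra.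
  by apply: cvgM; [exact: cvg_cst|exact: continuous_inv_sqrB].
- by move=> s s0; rewrite divr_ge0 ?sqr_ge0 ?ltW.
- apply: (eq_has_integral _ _ (has_integral_inv_sqr_tail p0)) => //.
  by move=> s _; rewrite opprK [p + s]addrC.
Qed.

(** The kernel with arguments of opposite signs: the opposite of the Hilbert
    kernel, plus a term that is integrable on the negative half-line. *)
Lemma kernel_left p y : 0 < p -> y <= 0 ->
  K p y = - (p - y)^-1 + 2 * (p / (p - y) ^+ 2).
Proof.
move=> p0 y0; rewrite /calderon_kernel (gtr0_norm p0) (ler0_norm y0).
by field; rewrite gt_eqF//; lra.
Qed.

Lemma kernel_right p y : 0 < p -> 0 <= y -> p != y -> K p y = (p - y)^-1.
Proof.
move=> p0 y0 py; rewrite /calderon_kernel (gtr0_norm p0) (ger0_norm y0).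
by field; rewrite subr_eq0.
Qed.

(** The two terms in [(p - y) ^- 2] have the same integral over the negative
    half-line and cancel; only the logarithm coming from the opposite of the
    Hilbert kernel remains. *)
Lemma has_integral_kernel_left x c : 0 < x <= c ->
  has_integral `]-oo, 0] (fun y => K x y - K c y) (ln x - ln c).
Proof.
move=> /andP[x0 xc]; have c0 : 0 < c by lra.
have x0c : 0 < x <= c by rewrite x0.
have mD : measurable (`]-oo, 0] : set R) by [].
have A := has_integralN mD (has_integral_log_left x0c).
have B := has_integralZ 2 mD (has_integral_inv_sqr_left x0).
have C := has_integralZ (-2) mD (has_integral_inv_sqr_left c0).
have := has_integralD mD (has_integralD mD A B) C.
rewrite (_ : _ + _ = ln x - ln c); last by ring.
apply: eq_has_integral => // y; rewrite /= in_itv/= => y0.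
by rewrite !kernel_left//; ring.
Qed.

Lemma has_integral_kernel_middle x c a : 0 < a -> a < x -> x <= c ->
  has_integral `[0, a] (fun y => K x y - K c y)
    (ln x - ln (x - a) - (ln c - ln (c - a))).
Proof.
move=> a0 ax xc; pose F y := - ln (x - y) + ln (c - y).
rewrite (_ : _ - _ = F a - F 0); last by rewrite /F !subr0; ring.
suff : has_integral `[0, a] (fun y => (x - y)^-1 - (c - y)^-1) (F a - F 0).
  apply: eq_has_integral => // y; rewrite /= in_itv/= => /andP[y0 ya].
  by rewrite !kernel_right// ?gt_eqF//; lra.
apply: has_integral_FTC => // y /andP[y0 ya].
- have dx : is_derive y 1 (fun t => ln (x - t)) (- (x - y)^-1).
    by apply: is_derive_lnB; lra.
  have dc : is_derive y 1 (fun t => ln (c - t)) (- (c - y)^-1).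
    by apply: is_derive_lnB; lra.
  have := is_deriveD (is_deriveN dx) dc.
  by rewrite opprK.
- by apply: cvgB; apply: continuous_invB; rewrite gt_eqF//; lra.
Qed.

Lemma has_integral_kernel_right x c b : 0 < x -> x <= c -> c < b ->
  has_integral `[b, +oo[ (fun y => K x y - K c y) (ln (b - x) - ln (b - c)).
Proof.
move=> x0 xc cb; have cx : - c <= - x by lra.
have bc : 0 < b - c by lra.
apply: (eq_has_integral _ _ (has_integral_log_tail cx bc)) => //.
move=> y; rewrite /= in_itv/= andbT => yb.
rewrite !kernel_right//; try (by rewrite lt_eqF//; lra); try lra.
by rewrite -[x - y]opprB -[c - y]opprB !invrN; ring.
Qed.

(** Sum of the contributions of the negative half-line, of [0, a] and of
    [b, +oo[. The term in [x - a] and [b - x] is the opposite of the principal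
    value in [pv_kernel_interval]. *)
Lemma has_integral_kernel_outside x c a b :
  0 < a -> a < x -> x <= c -> c < b ->
  has_integral (~` `[a, b]) (fun y => K x y - K c y)
    (2 * (ln x - ln c) - (ln (x - a) - ln (b - x)) +
     (ln (c - a) - ln (b - c))).
Proof.
move=> a0 ax xc cb; have x0 : 0 < x by lra.
have x0c : 0 < x <= c by rewrite x0.
have L := has_integral_kernel_left x0c.
have M := has_integralD1 0 (measurable_itv _) (has_integral_kernel_middle a0 ax xc).
have {}M := has_integralD1 a (measurableD (measurable_itv _) (measurable_set1 _)) M.
have T := has_integralD1 b (measurable_itv _) (has_integral_kernel_right x0 xc cb).
have mM : measurable ((`[0, a] `\ 0 `\ a)%classic : set R).
  by do 2 apply: measurableD => //.
have mT : measurable ((`[b, +oo[ `\ b)%classic : set R) by exact: measurableD.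
have LM : [disjoint `]-oo, 0]%classic & (`[0, a] `\ 0 `\ a)%classic].
  apply/disj_setPS => y [] /=; rewrite !in_itv/= => y0 [[/andP[y0' _] yn0] _].
  by apply: yn0; apply/eqP; rewrite eq_le y0.
have LMT : [disjoint (`]-oo, 0] `|` (`[0, a] `\ 0 `\ a))%classic & (`[b, +oo[ `\ b)%classic].
  apply/disj_setPS => y [] /=; rewrite !in_itv/= andbT.
  by move=> [y0|[[/andP[y0 ya] _] _]] [by_ _]; lra.
have := has_integralU (measurableU _ _ (measurable_itv _) mM) mT LMT
  (has_integralU (measurable_itv _) mM LM L M) T.
rewrite (_ : _ `|` _ = ~` `[a, b]%classic).
  rewrite [X in has_integral _ _ X -> _](_ : _ = 2 * (ln x - ln c) -
    (ln (x - a) - ln (b - x)) + (ln (c - a) - ln (b - c)))//; ring.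
apply/seteqP; split => y /=; rewrite !in_itv/= ?andbT.
  move=> [[y0|[[/andP[y0 ya] _] yna]]|[yb ynb]]; apply/negP; rewrite negb_and -!ltNge.
  - by apply/orP; left; lra.
  - by rewrite lt_neqAle ya andbT; apply/orP; left; exact/eqP.
  - by rewrite [b < _]lt_neqAle yb andbT; apply/orP; right; apply/eqP => /esym.
move=> /negP; rewrite negb_and -!ltNge => /orP[ya|yb].
- left; have [y0|y0] := leP y 0; [by left|right].
  split; [split|]; first by rewrite (ltW y0) (ltW ya).
    by move/eqP; rewrite gt_eqF.
  by move/eqP; rewrite lt_eqF.
- by right; split; [exact: ltW|move=> /eqP; rewrite gt_eqF].
Qed.

(** The truncated integrals do not depend on the truncation [e] once it is
    smaller than the distances to [a] and [b], since the two logarithms of [e]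
    cancel. *)
Lemma pv_kernel_interval x a b : 0 <= a -> a < x -> x < b ->
  calderon_commutator (fun y => \1_`[a, b] y * 1) x = ln (x - a) - ln (b - x).
Proof.
move=> a0 ax xb; rewrite /calderon_commutator /pv_operator.
apply: cvg_lim => //; apply: cvg_near_cst; near=> e.
have e0 : 0 < e by near: e; exact: nbhs_right_gt.
have xae : e < x - a by near: e; apply: nbhs_right_lt; lra.
have bxe : e < b - x by near: e; apply: nbhs_right_lt; lra.
suff [_ <-] : has_integral ((`[a, x - e] `\ (x - e)) `|` (`[x + e, b] `\ (x + e)))
    (K x) (ln (x - a) - ln (b - x)).
  rewrite Rintegral_mkcond [RHS]Rintegral_mkcond; apply: eq_Rintegral => y _.
  rewrite !patchE mulr1 indicE; case: ifPn => [|].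
    rewrite inE/= => exy; case: ifPn.
      rewrite inE => h; rewrite mem_set ?mulr1//.
      by case: h => /= -[]; rewrite !in_itv/= => /andP[] ? ? ?; apply/andP; split; lra.
    rewrite notin_setE/= => /not_orP[h1 h2].
    rewrite memNset ?mulr0//= in_itv/= => /andP[ay yb].
    move: exy; rewrite ltr_normr => /orP[exy|exy].
      apply: h1; rewrite in_itv/= ay/=; split; first lra.
      by move=> yE; rewrite yE in exy; lra.
    apply: h2; rewrite in_itv/= yb andbT; split; first lra.
    by move=> yE; rewrite yE in exy; lra.
  rewrite notin_setE/= => nexy; case: ifPn => //; rewrite inE => h; exfalso.
  apply: nexy; rewrite ltr_normr; apply/orP.
  case: h => /= -[]; rewrite !in_itv/= => /andP[] y1 y2 /eqP yn; [left|right].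
    have : y < x - e by rewrite lt_neqAle yn.
    lra.
  have : x + e < y by rewrite lt_neqAle eq_sym yn.
  lra.
have L : has_integral `[a, x - e] (K x) (ln (x - a) - ln e).
  pose F y := - ln (x - y).
  rewrite [X in has_integral _ _ X](_ : _ = F (x - e) - F a); last by rewrite /F subKr; ring.
  suff : has_integral `[a, x - e] (fun y => (x - y)^-1) (F (x - e) - F a).
    apply: eq_has_integral => // y; rewrite /= in_itv/= => /andP[ay yx].
    by rewrite kernel_right// ?gt_eqF//; lra.
  apply: has_integral_FTC; first lra.
    move=> y /andP[ay yx]; rewrite -[X in is_derive _ _ _ X]opprK.
    by apply: is_deriveN; apply: is_derive_lnB; lra.
  by move=> y /andP[ay yx]; apply: continuous_invB; rewrite gt_eqF//; lra.
have T : has_integral `[x + e, b] (K x) (ln e - ln (b - x)).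
  pose F y := - ln (y - x).
  rewrite [X in has_integral _ _ X](_ : _ = F b - F (x + e)); last first.
    by rewrite /F addrAC subrr add0r; ring.
  suff : has_integral `[x + e, b] (fun y => - (y - x)^-1) (F b - F (x + e)).
    apply: eq_has_integral => // y; rewrite /= in_itv/= => /andP[xy yb].
    rewrite kernel_right// ?lt_eqF//; try lra.
    by rewrite -[x - y]opprB invrN.
  apply: has_integral_FTC; first lra.
    by move=> y /andP[xy yb]; apply: is_deriveN; apply: is_derive_lnD; lra.
  by move=> y /andP[xy yb]; apply: cvgN; apply: continuous_invD; rewrite gt_eqF//; lra.
rewrite [X in has_integral _ _ X](_ : _ = ln (x - a) - ln e + (ln e - ln (b - x))); last by ring.
apply: has_integralU.
- exact: measurableD.
- exact: measurableD.
- apply/disj_setPS => y [] /=; rewrite !in_itv/= => -[/andP[_ y1] _] [/andP[y2 _] _].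
  lra.
- exact: has_integralD1.
- exact: has_integralD1.
Unshelve. all: by end_near. Qed.

End KernelTails.

(** * Oscillation over a cube *)

Import HBNNSimple.

(** The integral of a nonnegative function is a supremum over the simple
    functions below it, so a pointwise bound on a measurable set suffices;
    [T_Q f] is a principal value, known here through pointwise estimates only. *)
Lemma mul_measure_le_integral d (T : measurableType d) (R : realType)
    (mu : {measure set T -> \bar R}) (D A : set T) (f : T -> R) (k : R) :
  measurable A -> A `<=` D -> 0 <= k ->
  (forall x, D x -> 0 <= f x) -> (forall x, A x -> k <= f x) ->
  (k%:E * mu A <= \int[mu]_(x in D) (f x)%:E)%E.
Proof.
move=> mA AD k0 f0 kf; rewrite ge0_integralE//.
pose h := scale_nnsfun (indic_nnsfun R mA) k0.
have <- : sintegral mu h = (k%:E * mu A)%E.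
  rewrite -(sintegral_indic mu A) -(sintegralrM mu k (indic_nnsfun R mA)).
  exact: eq_sintegral.
apply: ereal_sup_ubound; exists h => // x /=.
rewrite /patch mindicE; have [xA|xA] := boolP (x \in A).
  by rewrite mulr1 mem_set ?lee_fin ?kf//; [exact/set_mem|exact/AD/set_mem].
rewrite mulr0; case: ifPn => // xD; rewrite lee_fin; exact/f0/set_mem.
Qed.

Section Oscillation.
Context {R : realType}.
Implicit Types (E : set R) (f g : R -> R) (c l k u v : R).
Local Notation mu := (@lebesgue_measure R).

Lemma measure_cube c l : 0 < l -> mu (cube c l) = l%:E.
Proof.
move=> l0; rewrite /cube lebesgue_measure_itv/= lte_fin ifT; last by lra.
by rewrite -EFinD; congr EFin; lra.
Qed.

Lemma le_iavg_cube f c l k : 0 < l ->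
  (\int[mu]_(x in cube c l) `|f x|%:E <= (k * l)%:E)%E ->
  (iavg f (cube c l) <= k%:E)%E.
Proof.
move=> l0 fk; rewrite /iavg measure_cube// inver gt_eqF//.
rewrite (_ : k = l^-1 * (k * l)); last by field; rewrite gt_eqF.
by rewrite EFinM lee_wpmul2l// lee_fin invr_ge0 ltW.
Qed.

Lemma ge_iavg_cube f c l k : 0 < l ->
  ((k * l)%:E <= \int[mu]_(x in cube c l) `|f x|%:E)%E ->
  (k%:E <= iavg f (cube c l))%E.
Proof.
move=> l0 fk; rewrite /iavg measure_cube// inver gt_eqF//.
rewrite (_ : k = l^-1 * (k * l)); last by field; rewrite gt_eqF.
by rewrite EFinM lee_wpmul2l// lee_fin invr_ge0 ltW.
Qed.

Lemma oscillation_ge0 g c l : (0 <= oscillation g c l)%E.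
Proof. by apply/ereal_infP => _ [b _ <-]; exact: iavg_ge0. Qed.

(** Any constant [b] is at distance at least [(v - u) / 2] from all the values
    of [g] on one of the two sets. *)
Lemma oscillation_gap g c l E1 E2 u v k : 0 < l -> u <= v ->
  measurable E1 -> measurable E2 -> E1 `<=` cube c l -> E2 `<=` cube c l ->
  mu E1 = (k * l)%:E -> mu E2 = (k * l)%:E ->
  (forall x, E1 x -> g x <= u) -> (forall x, E2 x -> v <= g x) ->
  ((k * ((v - u) / 2))%:E <= oscillation g c l)%E.
Proof.
move=> l0 uv mE1 mE2 E1Q E2Q muE1 muE2 gu gv.
apply/ereal_infP => _ [b _ <-]; apply: ge_iavg_cube => //.
have [bm|bm] := leP ((u + v) / 2) b.
- rewrite (_ : (_ * _)%:E = (((v - u) / 2)%:E * mu E1)%E); last first.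
    by rewrite muE1 -EFinM; congr EFin; ring.
  apply: mul_measure_le_integral => //; first lra.
  by move=> x /gu gx; rewrite ler_normr; apply/orP; right; lra.
- rewrite (_ : (_ * _)%:E = (((v - u) / 2)%:E * mu E2)%E); last first.
    by rewrite muE2 -EFinM; congr EFin; ring.
  apply: mul_measure_le_integral => //; first lra.
  by move=> x /gv gx; rewrite ler_normr; apply/orP; left; lra.
Qed.

End Oscillation.

(** * A family of truncated logarithms *)

Definition truncated_log {R : realType} (N y : R) : R :=
  ln (1 + Num.min `|y| N).

Section TruncatedLog.
Context {R : realType}.
Implicit Types (A N c l x y : R).
Local Notation mu := (@lebesgue_measure R).

Lemma continuous_ln1D (h : R -> R) x : 0 <= h x -> {for x, continuous h} ->
  {for x, continuous (fun y => ln (1 + h y))}.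
Proof.
move=> hx ch.
have c1 : 1 + h y @[y --> x] --> 1 + h x by apply: cvgD => //; exact: cvg_cst.
apply: (continuous_cvg (h := @ln R) _ _ c1).
by apply: continuous_ln; lra.
Qed.

Lemma continuous_truncated_log N : 0 <= N -> continuous (truncated_log N).
Proof.
move=> N0 x; apply: (@continuous_ln1D (fun y => Num.min `|y| N)).
  by rewrite le_min normr_ge0.
by apply: continuous_min; [apply: cvg_norm; exact: cvg_id|exact: cvg_cst].
Qed.

Lemma truncated_log_ge0 N y : 0 <= N -> 0 <= truncated_log N y.
Proof. by move=> N0; rewrite ln_ge0// lerDl le_min normr_ge0. Qed.

Lemma truncated_log_far N y : N <= `|y| -> truncated_log N y = ln (1 + N).
Proof. by move=> Ny; rewrite /truncated_log min_r. Qed.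

(** The mean over [-A, A] of the distance from [ln (1 + |y|)] to its maximum
    stays below 1 as [A] grows. *)
Lemma log_defect A : 0 < A ->
  has_integral `[- A, A] (fun y => ln (1 + A) - ln (1 + `|y|))
    (2 * (A - ln (1 + A))).
Proof.
move=> A0; pose w y : R := ln (1 + A) - ln (1 + `|y|).
have cw x : {for x, continuous w}.
  apply: cvgB; first exact: cvg_cst.
  apply: (@continuous_ln1D Num.norm) => //; apply: cvg_norm; exact: cvg_id.
pose F y : R := y * (1 + ln (1 + A)) - (y + 1) * ln (y + 1).
have P : has_integral `[0, A] w (A - ln (1 + A)).
  rewrite (_ : A - _ = F A - F 0); last first.
    by rewrite /F add0r ln1 [A + 1]addrC; ring.
  apply: has_integral_FTC => // y /andP[y0 yA].
  have d1 : is_derive y 1 (fun t => ln (t + 1)) (y + 1)^-1.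
    by apply: is_derive_lnD; lra.
  have d2 : is_derive y 1 (fun t : R => t + 1) 1.
    by rewrite -[X in is_derive _ _ _ X]addr0; exact: is_deriveD.
  have d3 : is_derive y 1 (fun t : R => t * (1 + ln (1 + A))) (1 + ln (1 + A)).
    have d4 := @is_deriveM _ _ id (cst (1 + ln (1 + A))) y 1 1 0
      (is_derive_id _ _) (is_derive_cst _ _ _).
    by apply: (is_derive_eq d4); rewrite scaler0 add0r /cst; exact: mulr1.
  have d5 := is_deriveB d3 (is_deriveM d2 d1).
  apply: (is_derive_eq d5); rewrite /w (ger0_norm y0) [1 + y]addrC.
  rewrite -[_ *: _ + _]/((y + 1) * (y + 1)^-1 + ln (y + 1) * 1).
  rewrite mulfV ?gt_eqF//; last lra.
  by ring.
have M : has_integral `[- A, - 0] w (A - ln (1 + A)).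
  apply: has_integral_oppr; [exact: ltW|by move=> x _; exact: cw|].
  by apply: (eq_has_integral _ _ P) => // y _; rewrite /w normrN.
rewrite oppr0 in M.
have {}M := has_integralD1 0 (measurable_itv _) M.
have mM : measurable ((`[- A, 0] `\ 0)%classic : set R) by exact: measurableD.
rewrite (_ : 2 * _ = A - ln (1 + A) + (A - ln (1 + A))); last by ring.
rewrite (_ : `[- A, A]%classic = (`[- A, 0] `\ 0) `|` `[0, A]).
  apply: has_integralU => //; apply/disj_setPS => y [] /=.
  rewrite !in_itv/= => -[/andP[_ y0] yn] /andP[y0' _].
  by apply: yn; apply/eqP; rewrite eq_le y0.
apply/seteqP; split => y /=; rewrite !in_itv/=.
  move=> /andP[Ay yA]; have [y0|y0] := leP 0 y; [by right|left].
  by split; [rewrite Ay ltW|move=> yE; rewrite yE ltxx in y0].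
by move=> [[/andP[? ?] _]|/andP[? ?]]; apply/andP; split; lra.
Qed.

Lemma log_defect_le A : 0 < A ->
  (\int[mu]_(y in `[(- A)%R, A]) (ln (1 + A) - ln (1 + `|y|))%:E
     <= (2 * A)%:E)%E.
Proof.
move=> A0; have [intw wE] := log_defect A0.
rewrite -[leLHS]fineK; last exact: integrable_fin_num intw.
rewrite lee_fin [leLHS]wE ler_pM2l// gerBl ln_ge0//; lra.
Qed.

(** Truncation is a contraction, so it does not increase the distance to the
    value at [A]. *)
Lemma truncated_log_defect N A x : 0 <= N -> `|x| <= A ->
  `|truncated_log N x - truncated_log N A| <= ln (1 + A) - ln (1 + `|x|).
Proof.
move=> N0 xA; have x0 := normr_ge0 x; have A0 : 0 <= A by lra.
have lxA : ln (1 + `|x|) <= ln (1 + A) by rewrite ler_ln ?posrE; lra.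
have [Nx|xN] := leP N `|x|.
  rewrite !truncated_log_far//; last by rewrite ger0_norm// (le_trans Nx).
  by rewrite subrr normr0 subr_ge0.
have -> : truncated_log N x = ln (1 + `|x|) by rewrite /truncated_log min_l ?ltW.
have m0 : `|x| <= Num.min `|A| N by rewrite le_min (ger0_norm A0) xA ltW.
have m1 : Num.min `|A| N <= A by rewrite ge_min (ger0_norm A0) lexx.
have b1 : ln (1 + `|x|) <= truncated_log N A.
  by rewrite /truncated_log ler_ln ?posrE; lra.
have b2 : truncated_log N A <= ln (1 + A).
  by rewrite /truncated_log ler_ln ?posrE; lra.
by rewrite ler0_norm; lra.
Qed.

End TruncatedLog.

Section TruncatedLogBMO.
Context {R : realType}.
Implicit Types (A N c l x y : R).
Local Notation mu := (@lebesgue_measure R).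

Lemma measurable_truncated_log_diff N b (D : set R) : 0 <= N -> measurable D ->
  measurable_fun D (fun x => `|truncated_log N x - b|%:E).
Proof.
move=> N0 mD; apply/measurable_EFinP; apply: measurable_funTS.
apply: continuous_measurable_fun => x; apply: cvg_norm; apply: cvgB.
  exact: continuous_truncated_log.
exact: cvg_cst.
Qed.

Lemma measurable_log_defect A (D : set R) : measurable D ->
  measurable_fun D (fun x => (ln (1 + A) - ln (1 + `|x|))%:E).
Proof.
move=> mD; apply/measurable_EFinP; apply: measurable_funTS.
apply: continuous_measurable_fun => x; apply: cvgB; first exact: cvg_cst.
by apply: (@continuous_ln1D _ Num.norm) => //; apply: cvg_norm; exact: cvg_id.
Qed.

(** The competitor is the largest value of the function on the cube. *)
Lemma oscillation_truncated_log N c l : 0 <= N -> 0 < l ->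
  (oscillation (truncated_log N) c l <= 3%:E)%E.
Proof.
move=> N0 l0; pose A := `|c| + l / 2; have c0 := normr_ge0 c.
have A0 : 0 < A by rewrite /A; lra.
apply: (@le_trans _ _
  (iavg (fun x => truncated_log N x - truncated_log N A) (cube c l))).
  by apply: ereal_inf_lbound; exists (truncated_log N A).
have QA x : cube c l x -> `|x| <= A.
  rewrite /cube /= in_itv/= => /andP[x1 x2]; rewrite ler_norml.
  have := ler_norm c; have := lerNnormlW (lexx `|c|).
  by rewrite /A => h1 h2; apply/andP; split; lra.
have mQ : measurable (cube c l) by exact: measurable_itv.
apply: le_iavg_cube => //.
apply: (@le_trans _ _
    (\int[mu]_(x in cube c l) (ln (1 + A) - ln (1 + `|x|))%:E)%E).
  apply: ge0_le_integral => //.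
  - exact: measurable_truncated_log_diff.
  - exact: measurable_log_defect.
  - by move=> x /QA xA; rewrite lee_fin truncated_log_defect.
have [lc|cl] := leP l (1 + `|c|).
  (* A short cube: [1 + |x|] varies by a factor at most 3, and [ln 3 < 3]. *)
- rewrite EFinM -(measure_cube c l0) -integral_cst//.
  apply: ge0_le_integral => //.
  + move=> x /QA xA; have x0 := normr_ge0 x.
    by rewrite lee_fin subr_ge0 ler_ln ?posrE; lra.
  + exact: measurable_log_defect.
  + move=> x Qx; have xA := QA _ Qx; have x0 := normr_ge0 x.
    rewrite lee_fin -ln_div ?posrE; try lra.
    apply: (@le_trans _ _ (ln 3)); last by apply/ltW/ln_sublinear; lra.
    rewrite ler_ln ?posrE; try lra; last by apply: divr_gt0; lra.
    rewrite ler_pdivrMr; last lra.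
    have cx : `|c| <= `|x| + l / 2.
      rewrite -(subrK x c) addrC (le_trans (ler_normD _ _))// lerD2l.
      move: Qx; rewrite /cube /= in_itv/= ler_norml => /andP[? ?].
      by apply/andP; split; lra.
    by rewrite /A; lra.
  (* A long cube: it is comparable with the symmetric interval containing it. *)
- apply: (@le_trans _ _
      (\int[mu]_(x in `[(- A)%R, A]) (ln (1 + A) - ln (1 + `|x|))%:E)%E).
    apply: ge0_subset_integral => //.
    + exact: measurable_log_defect.
    + move=> x; rewrite /= in_itv/= -ler_norml => xA; have x0 := normr_ge0 x.
      by rewrite lee_fin subr_ge0 ler_ln ?posrE; lra.
    + by move=> x /QA; rewrite /= in_itv/= -ler_norml.
  by rewrite (le_trans (log_defect_le A0))// lee_fin /A; lra.
Qed.

Lemma BMO_seminorm_truncated_log N : 0 <= N ->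
  (BMO_seminorm (truncated_log N) <= 3%:E)%E.
Proof.
move=> N0; apply: ge_ereal_sup => _ [[c l] /= l0 <-].
exact: oscillation_truncated_log.
Qed.

Lemma BMO_truncated_log N : 0 <= N -> BMO (truncated_log N).
Proof.
move=> N0; split; last first.
  by rewrite (le_lt_trans (BMO_seminorm_truncated_log N0))// ltry.
have cf := continuous_truncated_log N0.
split; [exact: continuous_measurable_fun|exact: openT|move=> D _ cD].
have := @continuous_compact_integrable _ (truncated_log N) D cD.
by case/(_ (continuous_subspaceT cf))/integrableP.
Qed.

Lemma mean_truncated_log N : 0 <= N -> `|mean (truncated_log N) 0 1| <= 1.
Proof.
move=> N0; have mQ : measurable (cube (0 : R) 1) by exact: measurable_itv.
have intf : mu.-integrable (cube 0 1) (EFin \o truncated_log N).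
  by apply: integrable_itv_continuous => x _; exact: continuous_truncated_log.
rewrite /mean invr1 mul1r ger0_norm; last first.
  by apply: Rintegral_ge0 => x _; exact: truncated_log_ge0.
rewrite [leRHS](_ : 1 = \int[mu]_(x in cube 0 1) 1); last first.
  rewrite Rintegral_cst// [X in fine X](_ : _ = 1%:E) ?mul1r//.
  exact: measure_cube.
apply: le_Rintegral => //.
  by apply: integrable_itv_continuous => x _; exact: cvg_cst.
move=> x; rewrite /cube/= in_itv/= => /andP[x1 x2].
have x0 : 0 <= Num.min `|x| N by rewrite le_min normr_ge0.
have xh : `|x| <= 1 by rewrite ler_norml; apply/andP; split; lra.
have mh : Num.min `|x| N <= 1 by rewrite ge_min xh.
apply: (@le_trans _ _ (Num.min `|x| N)) => //.
by rewrite /truncated_log le_ln1Dx//; lra.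
Qed.

Lemma BMO_norm_truncated_log N : 0 <= N ->
  (BMO_norm (truncated_log N) <= 4%:E)%E.
Proof.
move=> N0; rewrite (_ : 4 = 3 + 1); last by lra.
rewrite EFinD; apply: leeD; first exact: BMO_seminorm_truncated_log.
by rewrite lee_fin mean_truncated_log.
Qed.

End TruncatedLogBMO.

(** * Growth of the action on truncated logarithms *)

Section Action.
Context {R : realType}.
Implicit Types (N c l x y : R).
Local Notation mu := (@lebesgue_measure R).
Local Notation K := (@calderon_kernel R).
Local Notation f := (@truncated_log R).

Lemma double_cube N : cube (4 * N) (2 * (2 * N)) = `[2 * N, 6 * N]%classic.
Proof.
rewrite /cube (_ : 4 * N - _ = 2 * N); last by lra.
by rewrite (_ : 4 * N + _ = 6 * N)//; lra.
Qed.

(** By the triangle inequality the numerator is at most [|x - y|]. *)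
Lemma norm_kernel_le x y k : 0 < k -> k <= `|x - y| -> `|K x y| <= k^-1.
Proof.
move=> k0 kxy; have xy0 : 0 < `|x - y| by exact: lt_le_trans kxy.
rewrite /calderon_kernel normrM normfV normrX.
rewrite (@le_trans _ _ (`|x - y| / `|x - y| ^+ 2))//.
  by rewrite ler_wpM2r ?invr_ge0 ?exprn_ge0// ler_dist_dist.
rewrite expr2 invfM mulrA mulfV ?gt_eqF// mul1r.
by rewrite lef_pV2.
Qed.

(** The truncated logarithm equals [ln (1 + N)] outside [-N, N], and on [-N, N]
    the kernels are bounded by [(2 N)^-1], so the integral is dominated by a
    mean value bounded by [log_defect]. *)
Lemma norm_far_field_le N x : 0 < N -> 3 * N <= x ->
  `|\int[mu]_(y in ~` `[2 * N, 6 * N])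
      ((K x y - K (4 * N) y) * (f N y - ln (1 + N)))| <= 2.
Proof.
move=> N0 Nx; pose u y := (K x y - K (4 * N) y) * (f N y - ln (1 + N)).
have -> : \int[mu]_(y in ~` `[2 * N, 6 * N]) u y =
          \int[mu]_(y in `[- N, N]) u y.
  rewrite Rintegral_mkcond [RHS]Rintegral_mkcond; apply: eq_Rintegral => y _.
  rewrite !patchE; have [yN|Ny] := leP `|y| N.
    move: yN; rewrite ler_norml => yN; rewrite !mem_set//= in_itv/=.
    by move/andP: yN => [? ?] /andP[? ?]; lra.
  have -> : u y = 0 by rewrite /u truncated_log_far ?subrr ?mulr0// ltW.
  by do 2 case: ifP.
have intu : mu.-integrable `[- N, N] (EFin \o u).
  apply: integrable_itv_continuous => y /andP[y1 y2]; apply: cvgM.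
    by apply: cvgB; apply: continuous_kernel; rewrite gt_eqF//; lra.
  by apply: cvgB; [apply: continuous_truncated_log; exact: ltW|exact: cvg_cst].
apply: (le_trans (le_normr_Rintegral _ intu)) => //.
have [intw wE] := has_integralZ N^-1 (measurable_itv _) (log_defect N0).
apply: (@le_trans _ _ (\int[mu]_(y in `[- N, N])
    (N^-1 * (ln (1 + N) - ln (1 + `|y|))))).
  apply: le_Rintegral => //; first exact: integrable_norm.
  move=> y; rewrite /= in_itv/= => yN.
  have y_le : `|y| <= N by rewrite ler_norml.
  move/andP: yN => [y1 y2].
  rewrite /u normrM; apply: ler_pM => //.
    rewrite (_ : N^-1 = (2 * N)^-1 + (2 * N)^-1); last first.
      by field; rewrite gt_eqF.
    by rewrite (le_trans (ler_normB _ _))// lerD// norm_kernel_le//;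
      rewrite ?ger0_norm; lra.
  have := truncated_log_defect (ltW N0) y_le.
  by rewrite [f N N]truncated_log_far// ger0_norm// ltW.
rewrite wE mulrCA ler_piMr// mulrBr mulVf ?gt_eqF// gerBl.
by rewrite mulr_ge0 ?invr_ge0 ?(ltW N0)// ln_ge0//; lra.
Qed.

(** Within the centred formula for T_Q 1 the constants cancel because the centre
    [4 N] is equidistant from the endpoints of [2Q = [2 N, 6 N]]; the local
    term of T_Q (f - f_{2Q}) is zero. *)
Lemma local_action_truncated_log N x : 0 < N -> 3 * N <= x <= 4 * N ->
  `|local_action (@calderon_commutator R) K (4 * N) (2 * N) (f N) x
     - ln (1 + N) * (2 * (ln x - ln (4 * N)))| <= 2.
Proof.
move=> N0 /andP[Nx xN].
have fm y : `[2 * N, 6 * N]%classic y -> f N y = ln (1 + N).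
  rewrite /= in_itv/= => /andP[y1 y2].
  by rewrite truncated_log_far// ger0_norm; lra.
have -> : local_action (@calderon_commutator R) K (4 * N) (2 * N) (f N) x =
    ln (1 + N) * (2 * (ln x - ln (4 * N))) +
    \int[mu]_(y in ~` `[2 * N, 6 * N])
      ((K x y - K (4 * N) y) * (f N y - ln (1 + N))).
  rewrite /local_action.
  have -> : mean (f N) (4 * N) (2 * (2 * N)) = ln (1 + N).
    rewrite /mean (@eq_Rintegral _ _ _ mu _ (fun=> ln (1 + N))); last first.
      by move=> y; rewrite inE double_cube; exact: fm.
    rewrite Rintegral_cst; last exact: measurable_itv.
    rewrite [X in fine X](_ : _ = (2 * (2 * N))%:E)/=.
      by field; rewrite gt_eqF.
    by apply: measure_cube; lra.
  congr (_ * _ + _).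
    rewrite /local_action0 double_cube pv_kernel_interval; try lra.
    under eq_Rintegral do rewrite mulr1.
    have [||||_ ->] := @has_integral_kernel_outside R x (4 * N) (2 * N) (6 * N); try lra.
    by rewrite (_ : 4 * N - 2 * N = 6 * N - 4 * N); [ring|lra].
  rewrite /local_action0 double_cube -[RHS]add0r; congr (_ + _).
  rewrite /calderon_commutator /pv_operator.
  apply: cvg_lim => //; apply: cvg_near_cst; near=> e.
  rewrite (@eq_Rintegral _ _ _ mu _ (fun=> 0)); first by rewrite /Rintegral integral0.
  move=> y _; rewrite indicE; case: (boolP (y \in _)) => yQ; last by rewrite mul0r mulr0.
  by move: yQ; rewrite inE => /fm ->; rewrite subrr !mulr0.
by rewrite addrAC subrr add0r; exact: norm_far_field_le.
Unshelve. all: by end_near. Qed.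

(** The sets compared are the first eighth of [Q = [3 N, 5 N]] and the eighth of
    [Q] ending at its centre, on which [x] is at most [13 N / 4] and at least
    [15 N / 4]. *)
Lemma BMO_action_truncated_log N : 0 < N ->
  (((ln (1 + N) * (2 * ln (15 / 13)) - 4) / 16)%:E <=
   BMO_action_seminorm (@calderon_commutator R) K (f N))%E.
Proof.
move=> N0; have m0 : 0 <= ln (1 + N) by rewrite ln_ge0//; lra.
have [small|big] := leP (ln (1 + N) * (2 * ln (15 / 13))) 4.
  apply: (@le_trans _ _ 0%E); first by rewrite lee_fin; lra.
  apply: (@le_trans _ _
    (oscillation (local_action (@calderon_commutator R) K 0 1 (f N)) 0 1)).
    exact: oscillation_ge0.
  by apply: ereal_sup_ubound; exists (0, 1) => //=.
apply: (@le_trans _ _ (oscillation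
    (local_action (@calderon_commutator R) K (4 * N) (2 * N) (f N))
    (4 * N) (2 * N))); last first.
  by apply: ereal_sup_ubound; exists (4 * N, 2 * N) => //=; lra.
pose u := ln (1 + N) * (2 * (ln (13 / 4 * N) - ln (4 * N))) + 2.
pose v := ln (1 + N) * (2 * (ln (15 / 4 * N) - ln (4 * N))) - 2.
have uv : v - u = ln (1 + N) * (2 * ln (15 / 13)) - 4.
  rewrite /u /v (_ : 15 / 13 = (15 / 4 * N) / (13 / 4 * N)); last first.
    by field; rewrite gt_eqF.
  by rewrite ln_div ?posrE; [ring|lra|lra].
rewrite (_ : (_ / 16) = 8^-1 * ((v - u) / 2)); last by rewrite uv; field.
apply: (@oscillation_gap _ _ _ _ `[3 * N, 13 / 4 * N] `[15 / 4 * N, 4 * N]).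
- by lra.
- by lra.
- by [].
- by [].
- by move=> x; rewrite /cube /= !in_itv/= => /andP[? ?]; apply/andP; split; lra.
- by move=> x; rewrite /cube /= !in_itv/= => /andP[? ?]; apply/andP; split; lra.
- rewrite lebesgue_measure_itv/= lte_fin ifT; last lra.
  by rewrite -EFinD; congr EFin; lra.
- rewrite lebesgue_measure_itv/= lte_fin ifT; last lra.
  by rewrite -EFinD; congr EFin; lra.
- move=> x; rewrite /= in_itv/= => /andP[x1 x2].
  have : 3 * N <= x <= 4 * N by apply/andP; split; lra.
  move=> /(local_action_truncated_log N0) /ler_normlW.
  rewrite lerBlDr => /le_trans; apply; rewrite /u addrC lerD2r.
  rewrite ler_wpM2l// ler_pM2l// lerD2r ler_ln ?posrE; lra.
- move=> x; rewrite /= in_itv/= => /andP[x1 x2].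
  have : 3 * N <= x <= 4 * N by apply/andP; split; lra.
  move=> /(local_action_truncated_log N0) /lerNnormlW.
  rewrite lerBrDr addrC; apply: le_trans; rewrite /v lerD2r.
  rewrite ler_wpM2l// ler_pM2l// lerD2r ler_ln ?posrE; lra.
Qed.

End Action.

Unset Implicit Arguments.

Theorem mainTheorem3 (R : realType) :
  ~ exists C : R, forall f : R -> R, BMO f ->
      (BMO_action_seminorm calderon_commutator calderon_kernel f
        <= C%:E * BMO_norm f)%E.
Proof.
move=> [C HC].
have d0 : 0 < ln (15 / 13 : R) by rewrite ln_gt0//; lra.
(* With [ln (1 + N) = M] the lower bound is [4 |C| + 1 / 16], while the norm is
   at most 4. *)
pose M := (64 * `|C| + 5) / (2 * ln (15 / 13)).
have C0 := normr_ge0 C.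
have M0 : 0 < M by rewrite divr_gt0//; lra.
pose N := expR M - 1.
have N0 : 0 < N by rewrite subr_gt0 -expR0 ltr_expR.
have := HC _ (BMO_truncated_log (ltW N0)).
have /le_trans h := BMO_action_truncated_log N0.
move=> /h {h}.
have nf := BMO_norm_truncated_log (ltW N0).
have nf0 : (0 <= BMO_norm (truncated_log N))%E.
  apply: adde_ge0; last by rewrite lee_fin.
  apply: (@le_trans _ _ (oscillation (truncated_log N) 0 1)).
    exact: oscillation_ge0.
  by apply: ereal_sup_ubound; exists (0, 1) => //=.
move=> /le_trans h.
have : (C%:E * BMO_norm (truncated_log N) <= (`|C| * 4)%:E)%E.
  apply: (@le_trans _ _ (`|C|%:E * BMO_norm (truncated_log N))%E).
    by apply: lee_wpmul2r => //; rewrite lee_fin ler_norm.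
  by rewrite EFinM; apply: lee_wpmul2l => //; rewrite lee_fin.
have lnN : ln (1 + N) = M by rewrite /N addrC subrK expRK.
move=> /h; rewrite lee_fin lnN /M divfK; last by rewrite gt_eqF//; lra.
lra.
Qed.
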